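(* A marked group $(G,S)$ is finitely presented if and only if it has semi-decidable word problem and semi-decidable marked quotient problem. Moreover this result is uniform: there is an equivalence of subnumberings of the set of marked groups $$\nu_{FP}\equiv\nu_{RP}\wedge\nu_{MQA}.$$
   Context: A $k$-marked group is a pair $(G,S)$ with $G$ a group and $S=(s_1,\dots,s_k)\in G^k$ a tuple generating $G$. A morphism $(G,S)\to(H,S')$ of $k$-marked groups is a group homomorphism sending $s_i$ to $s_i'$ for each $i$; marked groups are considered up to isomorphism of marked groups. $(H,S')$ is a marked quotient of $(G,S)$ if there is a morphism $(G,S)\to(H,S')$. Groups marked by tuples of different lengths are incomparable. A subnumbering of a set $X$ is a map $\nu$ from a subset $\mathrm{dom}(\nu)\subseteq\mathbb{N}$ to $X$; if $\nu(p)=x$, $p$ is a $\nu$-name of $x$. For subnumberings $\nu,\mu$ of $X$, $\nu\le\mu$ means that there is a partial computable $F:\subseteq\mathbb{N}\to\mathbb{N}$ defined on $\mathrm{dom}(\nu)$ with $F(p)\in\mathrm{dom}(\mu)$ and $\mu(F(p))=\nu(p)$ for all $p\in\mathrm{dom}(\nu)$; $\nu\equiv\mu$ means $\nu\le\mu$ and $\mu\le\nu$. Let $\langle n,m\rangle$ be a computable bijection $\mathbb{N}^2\to\mathbb{N}$ with computable inverse. The conjunction $\nu\wedge\mu$ has domain $\{\langle p,q\rangle : p\in\mathrm{dom}(\nu),\,q\in\mathrm{dom}(\mu),\,\nu(p)=\mu(q)\}$ and $(\nu\wedge\mu)(\langle p,q\rangle)=\nu(p)$. Let $\mathcal{A}_n=\{x_1,\dots,x_n\}$,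 let $\theta_n:\mathbb{N}\to(\mathcal{A}_n\cup\mathcal{A}_n^{-1})^*$ be a natural computable bijection uniformly in $n\ge1$, let $\Delta$ be the standard numbering of finite subsets of $\mathbb{N}$ (a $\Delta$-name gives an explicit finite list of the elements), let $\varphi_0,\varphi_1,\dots$ be a standard enumeration of the partial computable functions and $W_i=\mathrm{dom}(\varphi_i)$. All presentations on $\mathcal{A}_n$ define groups marked by $(x_1,\dots,x_n)$. Define: - $\nu_{FP}(\langle n,m\rangle)=\langle\mathcal{A}_n\mid\theta_n(\Delta(m))\rangle$ (finite presentations); - $\nu_{RP}(\langle n,i\rangle)=\langle\mathcal{A}_n\mid\theta_n(W_i)\rangle$ (recursive presentations); a marked group is recursively presented if it is in the image of $\nu_{RP}$; - $\nu_{MQA}$ (marked quotient algorithms), a numbering of recursively presented marked groups: $\nu_{MQA}(\langle n,i\rangle)=(G,S)$, where $(G,S)$ is a recursively presented $n$-marked group, if and only if for all $j$, [$\nu_{RP}(\langle n,j\rangle)$ is a marked quotient of $(G,S)$ $\iff j\in W_i$]. Its domain consists of exactly those $\langle n,i\rangle$ for which such a $(G,S)$ exists (it is then unique up to isomorphism of marked groups). The word problem of a $k$-marked group $(G,S)$ is semi-decidable if there is an algorithm which, given a word in $(S\cup S^{-1})^*$, stops if and only if the word represents $1$ in $G$. The marked quotient problem of a $k$-marked group $(G,S)$ is the problem of deciding whether a marked group given by a recursive presentation is a marked quotient of $(G,S)$; it is semi-decidable if $\{j : \nu_{RP}(\langle k,j\rangle)\text{ is a marked quotient of }(G,S)\}$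 is computably enumerable. *)

(* Defs.v *)
From Stdlib Require Cantor.
From HB Require Import structures.
From mathcomp Require Import all_boot.
From mathcomp Require Import boolp classical_sets.

Set Implicit Arguments.
Unset Strict Implicit.
Unset Printing Implicit Defensive.

Local Open Scope classical_set_scope.

Definition pair_code (n m : nat) : nat := Cantor.to_nat (n, m).
Definition unpair (p : nat) : nat * nat := Cantor.of_nat p.

(* Kleene's partial recursive functions, as unary functions on codes of
   tuples. *)
Inductive code : Type :=
| Zero | Succ | Fst | Snd
| Pair of code & code
| Comp of code & code
| Prec of code & code
| Mu of code.

(* [eval c x y]: the partial function coded by [c] is defined at [x], with
   value [y].
   - [Prec f g] is primitive recursion:
       h <a, 0> = f a   and   h <a, n+1> = g <a, <n, h <a, n>>>;
   - [Mu f] is minimization: it sends x to the least y such that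
     f <x, y> = 0, all the values f <x, z> for z < y being defined. *)
Fixpoint eval (c : code) (x y : nat) : Prop :=
  match c with
  | Zero => y = 0
  | Succ => y = x.+1
  | Fst => y = (unpair x).1
  | Snd => y = (unpair x).2
  | Pair f g => exists u v, [/\ eval f x u, eval g x v & y = pair_code u v]
  | Comp f g => exists2 u, eval g x u & eval f u y
  | Prec f g =>
      let a := (unpair x).1 in
      (fix rec (n : nat) (r : nat) : Prop :=
         if n is n'.+1
         then exists2 r', rec n' r' & eval g (pair_code a (pair_code n' r')) r
         else eval f a r) (unpair x).2 y
  | Mu f =>
      eval f (pair_code x y) 0 /\
      forall z, z < y -> exists v, eval f (pair_code x z) v.+1
  end.

Lemma eval_functional (c : code) (x y z : nat) :
  eval c x y -> eval c x z -> y = z.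
Proof.
elim: c x y z => /=; try by move=> x y z -> ->.
- move=> f IHf g IHg x y z [u [v [fu gv ->]]] [u' [v' [fu' gv' ->]]].
  by rewrite (IHf _ _ _ fu fu') (IHg _ _ _ gv gv').
- move=> f IHf g IHg x y z [u gu fy] [v gv fz].
  by apply: IHf fy _; rewrite (IHg _ _ _ gu gv).
- move=> f IHf g IHg x; elim: (unpair x).2 => [|n IHn] y z; first exact: IHf.
  by move=> [r hr gr] [s hs gs]; apply: IHg gr _; rewrite (IHn _ _ hr hs).
- move=> f IHf x y z [fy ly] [fz lz].
  case: (ltngtP y z) => // [/lz|/ly] [v fv].
  + by have := IHf _ _ _ fy fv.
  + by have := IHf _ _ _ fz fv.
Qed.

Definition partial_computable (F : nat -> option nat) : Prop :=
  exists c, forall x y, F x = Some y <-> eval c x y.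

(* The Goedel numbering of codes; it is a bijection code -> nat. *)
Fixpoint godel (c : code) : nat :=
  match c with
  | Zero => 0
  | Succ => 1
  | Fst => 2
  | Snd => 3
  | Pair f g => 4 * pair_code (godel f) (godel g) + 4
  | Comp f g => 4 * pair_code (godel f) (godel g) + 5
  | Prec f g => 4 * pair_code (godel f) (godel g) + 6
  | Mu f => 4 * godel f + 7
  end.

(* phi_i(x) is defined, with value y. *)
Definition phi (i x y : nat) : Prop := exists2 c, godel c = i & eval c x y.

Definition W (i : nat) : set nat := [set x | exists y, phi i x y].

Definition ce (A : set nat) : Prop := exists i, W i = A.

(* Canonical indices of finite sets: the positions of the binary digits 1 of
   [m], all of which are < m. *)
Definition Delta (m : nat) : seq nat :=
  [seq i <- iota 0 m | odd (m %/ 2 ^ i)].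

Definition subnumbering (X : Type) := nat -> option X.

(* [p \in dom nu] and [nu p = x] together read [nu p = Some x]. *)
Definition sub_le (X : Type) (nu mu : subnumbering X) : Prop :=
  exists2 F, partial_computable F &
    forall p x, nu p = Some x -> exists2 q, F p = Some q & mu q = Some x.

Definition sub_equiv (X : Type) (nu mu : subnumbering X) : Prop :=
  sub_le nu mu /\ sub_le mu nu.

Definition sub_conj (X : Type) (nu mu : subnumbering X) : subnumbering X :=
  fun r => let: (p, q) := unpair r in
    match nu p, mu q with
    | Some x, Some y => if `[< x = y >] then Some x else None
    | _, _ => None
    end.

(* The letter (i, false) is x_i and (i, true) is its formal inverse. *)
Definition letter (n : nat) : Type := ('I_n * bool)%type.
Definition word (n : nat) : Type := seq (letter n).

Definition flip (n : nat) (a : letter n) : letter n := (a.1, ~~ a.2).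
Definition inv_word (n : nat) (w : word n) : word n := rev (map (@flip n) w).

Definition word_val (n : nat) (G : groupType) (s : 'I_n -> G) (w : word n) : G :=
  (\prod_(a <- w) (if a.2 then (s a.1)^-1 else s a.1))%g.

(* Bijective base-b numeration, least significant digit first, with digits
   0, ..., b-1 of values 1, ..., b. *)
Fixpoint digits_rec (fuel b m : nat) : seq nat :=
  if fuel is f.+1 then
    if m is m'.+1 then m' %% b :: digits_rec f b (m' %/ b) else [::]
  else [::].

(* The digit 2 i + e, with i < n and e < 2, stands for the letter (i, e). *)
Definition digit_letter (n d : nat) : option (letter n) :=
  omap (fun i : 'I_n => (i, odd d)) (insub d./2).

Definition theta (n m : nat) : word n :=
  pmap (@digit_letter n) (digits_rec m (2 * n) m).

Definition letter_digit (n : nat) (a : letter n) : nat := a.2 + a.1.*2.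

Fixpoint theta_inv (n : nat) (w : word n) : nat :=
  if w is a :: w' then (theta_inv w' * (2 * n) + letter_digit a).+1 else 0.

Lemma theta_bij (n : nat) : 0 < n -> bijective (theta n).
Proof.
move=> n0; have b0 : 0 < 2 * n by rewrite muln_gt0.
have dl (a : letter n) : letter_digit a < 2 * n.
  case: a => i e; rewrite /letter_digit /= mul2n.
  by case: e; rewrite ?ltn_double ?ltn_Sdouble.
have ld (a : letter n) : digit_letter n (letter_digit a) = Some a.
  case: a => i e; rewrite /digit_letter /letter_digit /= half_bit_double.
  by rewrite valK /= oddD odd_double addbF oddb.
have dK d : d < 2 * n ->
    exists2 a, digit_letter n d = Some a & letter_digit a = d.
  move=> dn; have hn : d./2 < n by rewrite ltn_half_double -mul2n.
  exists (Ordinal hn, odd d); first by rewrite /digit_letter insubT.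
  exact: odd_double_half.
exists (@theta_inv n).
- move=> m; rewrite /theta; move: (leqnn m); move: {2 3}m => f.
  elim: f m => [|f IHf] [|m] //=; rewrite ltnS => mf.
  have [a -> /= ->] := dK _ (ltn_pmod m b0).
  by rewrite IHf -?divn_eq // (leq_trans (leq_div _ _)).
- move=> w; rewrite /theta; move: (leqnn (theta_inv w)).
  move: {2 3}(theta_inv w) => f.
  elim: w f => [|a w IHw] [|f] //=; rewrite ltnS => wf.
  rewrite modnMDl modn_small // divnMDl // divn_small // addn0 ld /= IHw //.
  apply: leq_trans wf; apply: leq_trans (leq_addr _ _).
  by rewrite leq_pmulr.
Qed.

Record kmarked (n : nat) : Type := KMarked {
  mgroup :> groupType;
  mgen : 'I_n -> mgroup;
  mgenP : forall g : mgroup, exists w : word n, word_val mgen w = g }.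

Definition marked_hom (n : nat) (G H : kmarked n) (f : G -> H) : Prop :=
  {morph f : x y / (x * y)%g >-> (x * y)%g} /\
  (forall i, f (mgen G i) = mgen H i).

(* [H] is a marked quotient of [G]. *)
Definition marked_quotient (n : nat) (G H : kmarked n) : Prop :=
  exists f : G -> H, marked_hom f.

Definition marked_iso (n : nat) (G H : kmarked n) : Prop :=
  exists2 f : G -> H, marked_hom f & bijective f.

(* Marked groups are taken up to isomorphism, so that Leibniz equality on
   [marked_group] is isomorphism of marked groups. *)
Definition marked_class (n : nat) : Type :=
  {C : kmarked n -> Prop | exists G, C = marked_iso G}.

Definition cls (n : nat) (G : kmarked n) : marked_class n :=
  exist _ (marked_iso G) (ex_intro _ G erefl).

Definition marked_group : Type := {n : nat & marked_class n}.

Definition mk (n : nat) (G : kmarked n) : marked_group := existT _ n (cls G).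

(* Equality in the group <x_1, ..., x_n | R>: the least congruence on words
   killing the relators and the words x x^-1 and x^-1 x. *)
Inductive pres_eq (n : nat) (R : set (word n)) : word n -> word n -> Prop :=
| pres_refl u : pres_eq R u u
| pres_sym u v : pres_eq R u v -> pres_eq R v u
| pres_trans u v w : pres_eq R u v -> pres_eq R v w -> pres_eq R u w
| pres_cat u u' v v' :
    pres_eq R u u' -> pres_eq R v v' -> pres_eq R (u ++ v) (u' ++ v')
| pres_cancel a : pres_eq R [:: a; flip a] [::]
| pres_rel r : R r -> pres_eq R r [::].

Section Presentation.
Variables (n : nat) (R : set (word n)).
Local Open Scope quotient_scope.

Definition pres_eqb (u v : word n) : bool := `[< pres_eq R u v >].

Lemma pres_eqb_refl : reflexive pres_eqb.
Proof. by move=> u; apply/asboolP/pres_refl. Qed.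

Lemma pres_eqb_sym : symmetric pres_eqb.
Proof. by move=> u v; apply/asboolP/asboolP; apply: pres_sym. Qed.

Lemma pres_eqb_trans : transitive pres_eqb.
Proof.
move=> v u w /asboolP uv /asboolP vw; apply/asboolP; exact: pres_trans uv vw.
Qed.

Canonical pres_equiv :=
  EquivRel pres_eqb pres_eqb_refl pres_eqb_sym pres_eqb_trans.

Definition pres_type : Type := {eq_quot pres_equiv}.
HB.instance Definition _ := Choice.on pres_type.
HB.instance Definition _ := EqQuotient.on pres_type.

Lemma pres_piP (u v : word n) :
  \pi_pres_type u = \pi_pres_type v <-> pres_eq R u v.
Proof. by split=> [/eqmodP/asboolP|h]; [|apply/eqmodP/asboolP]. Qed.

Definition pres_one : pres_type := \pi_pres_type [::].
Definition pres_mul (x y : pres_type) : pres_type :=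
  \pi_pres_type (repr x ++ repr y).
Definition pres_inv (x : pres_type) : pres_type :=
  \pi_pres_type (inv_word (repr x)).

Lemma inv_word_cat (u v : word n) : inv_word (u ++ v) = inv_word v ++ inv_word u.
Proof. by rewrite /inv_word map_cat rev_cat. Qed.

Lemma flipK : involutive (@flip n).
Proof. by case=> i e; rewrite /flip /= negbK. Qed.

Lemma inv_wordK : involutive (@inv_word n).
Proof. by move=> w; rewrite /inv_word map_rev revK mapK //; apply: flipK. Qed.

Lemma pres_eq_mulwV (w : word n) : pres_eq R (w ++ inv_word w) [::].
Proof.
elim: w => [|a w IHw]; first exact: pres_refl.
rewrite -cat1s inv_word_cat -catA (catA w).
apply: pres_trans (pres_cancel R a); rewrite -[[:: a; _]]/([:: a] ++ inv_word [:: a]).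
apply: pres_cat; first exact: pres_refl.
exact: (pres_cat IHw (pres_refl _ _)).
Qed.

Lemma pres_eq_mulVw (w : word n) : pres_eq R (inv_word w ++ w) [::].
Proof. by rewrite -[X in _ ++ X]inv_wordK; apply: pres_eq_mulwV. Qed.

Lemma pres_eq_inv (u v : word n) :
  pres_eq R u v -> pres_eq R (inv_word u) (inv_word v).
Proof.
move=> uv; rewrite -[inv_word u]cats0.
apply: pres_trans (pres_cat (pres_refl R _) (pres_sym (pres_eq_mulwV v))) _.
rewrite catA -[X in pres_eq R _ X]cat0s; apply: pres_cat; last exact: pres_refl.
apply: pres_trans (pres_eq_mulVw u).
exact: pres_cat (pres_refl R _) (pres_sym uv).
Qed.

Lemma pres_reprP (u : word n) : pres_eq R (repr (\pi_pres_type u)) u.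
Proof. by apply/pres_piP; rewrite reprK. Qed.

Lemma pres_mul_pi (u v : word n) :
  pres_mul (\pi_pres_type u) (\pi_pres_type v) = \pi_pres_type (u ++ v).
Proof. by apply/pres_piP/pres_cat; apply: pres_reprP. Qed.

Lemma pres_inv_pi (u : word n) :
  pres_inv (\pi_pres_type u) = \pi_pres_type (inv_word u).
Proof. by apply/pres_piP/pres_eq_inv/pres_reprP. Qed.

Lemma pres_mulA : associative pres_mul.
Proof.
move=> x y z; rewrite -[x]reprK -[y]reprK -[z]reprK.
rewrite (pres_mul_pi (repr y)) (pres_mul_pi (repr x) (_ ++ _)).
by rewrite (pres_mul_pi (repr x)) (pres_mul_pi (_ ++ _)) catA.
Qed.

Lemma pres_mul1 : left_id pres_one pres_mul.
Proof. by move=> x; rewrite -[x]reprK pres_mul_pi. Qed.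

Lemma pres_mulr1 : right_id pres_one pres_mul.
Proof. by move=> x; rewrite -[x]reprK pres_mul_pi cats0. Qed.

Lemma pres_mulV : left_inverse pres_one pres_inv pres_mul.
Proof.
move=> x; rewrite -[x]reprK pres_inv_pi pres_mul_pi.
by apply/pres_piP/pres_eq_mulVw.
Qed.

Lemma pres_mulrV : right_inverse pres_one pres_inv pres_mul.
Proof.
move=> x; rewrite -[x]reprK pres_inv_pi pres_mul_pi.
by apply/pres_piP/pres_eq_mulwV.
Qed.

HB.instance Definition _ := isGroup.Build pres_type
  pres_mulA pres_mul1 pres_mulr1 pres_mulV pres_mulrV.

Definition pres_gen (i : 'I_n) : pres_type := \pi_pres_type [:: (i, false)].

Lemma pres_word_val (w : word n) : word_val pres_gen w = \pi_pres_type w.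
Proof.
elim: w => [|[i e] w IHw]; first by rewrite /word_val big_nil.
rewrite /word_val big_cons -/(word_val _ _) IHw -cat1s -pres_mul_pi /=.
by case: e; rewrite ?[(_^-1)%g]pres_inv_pi.
Qed.

Lemma pres_genP (g : pres_type) : exists w, word_val pres_gen w = g.
Proof. by exists (repr g); rewrite pres_word_val reprK. Qed.

Definition pres : kmarked n := KMarked pres_genP.

End Presentation.

(* Presentations are on n >= 1 generators: the names <0, m> are outside the
   domains of the three subnumberings. *)

Definition fp_group (n m : nat) : kmarked n :=
  pres (theta n @` [set i | i \in Delta m]).

Definition rp_group (n i : nat) : kmarked n := pres (theta n @` W i).

Definition nuFP : subnumbering marked_group := fun p =>
  let: (n, m) := unpair p in if 0 < n then Some (mk (fp_group n m)) else None.

Definition nuRP : subnumbering marked_group := fun p =>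
  let: (n, i) := unpair p in if 0 < n then Some (mk (rp_group n i)) else None.

Definition recursively_presented (n : nat) (G : kmarked n) : Prop :=
  exists p, nuRP p = Some (mk G).

Definition mqa_spec (n i : nat) (x : marked_group) : Prop :=
  exists G : kmarked n,
    [/\ x = mk G, recursively_presented G &
        forall j, marked_quotient G (rp_group n j) <-> W i j].

(* At most one [x] satisfies [mqa_spec n i x]: two recursively presented groups
   with the same marked quotients are marked quotients of each other. *)
Definition nuMQA : subnumbering marked_group := fun p =>
  let: (n, i) := unpair p in
  if pselect (exists x, mqa_spec n i x) is left ex_x
  then Some (projT1 (cid ex_x)) else None.

Definition finitely_presented (n : nat) (G : kmarked n) : Prop :=
  exists R : seq (word n), marked_iso G (pres [set r | r \in R]).

Definition semidecidable_WP (n : nat) (G : kmarked n) : Prop :=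
  ce [set w | word_val (mgen G) (theta n w) = 1%g].

Definition semidecidable_MQ (n : nat) (G : kmarked n) : Prop :=
  ce [set j | marked_quotient G (rp_group n j)].

(* Main.v *)
Require Import Defs.
From mathcomp Require Import all_boot.
From Stdlib Require Cantor Eqdep_dec.
From mathcomp Require Import boolp classical_sets.
From mathcomp Require Import zify.

(* If G = <A | R> with R finite, then H is a marked quotient of G exactly when
   the finitely many relators in R are trivial in H, which is semi-decidable
   uniformly in a recursive presentation of H.

   Conversely, let W i be the relators of a recursive presentation of G and W q
   the set of names of its marked quotients.  If a finite part of W i is a
   presentation of a marked quotient of G, it presents G, so it suffices to
   search for a finite subset of W i whose presentation has its name in W q.
   The search succeeds: otherwise consider, for a program e, the presentation
   that enumerates W i until e halts on the input e.  It is a marked quotient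
   of G exactly when e does not halt, so the complement of the halting problem
   would be c.e.

   Evaluation of codes and equality in a presented group are both inductively
   defined by rules with at most two premises; both are semi-decidable because
   a derivation is a finite object that can be checked. *)

Set Implicit Arguments.
Unset Strict Implicit.
Unset Printing Implicit Defensive.

Local Open Scope classical_set_scope.

(** * Computable functions and semi-decidable predicates *)

Arguments pair_code : simpl never.
Arguments unpair : simpl never.

Lemma pair_codeK (a b : nat) : unpair (pair_code a b) = (a, b).
Proof. exact: Cantor.cancel_of_to. Qed.

Lemma unpairK (p : nat) : pair_code (unpair p).1 (unpair p).2 = p.
Proof.
by rewrite /pair_code -surjective_pairing; apply: Cantor.cancel_to_of.
Qed.

Lemma pair_code_inj (a b c d : nat) :
  pair_code a b = pair_code c d -> a = c /\ b = d.
Proof. by move/(congr1 unpair); rewrite !pair_codeK => -[-> ->]. Qed.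

Lemma leq_pair_codel (a b : nat) : a <= pair_code a b.
Proof. by have := Cantor.to_nat_non_decreasing a b; rewrite /pair_code; lia. Qed.

Lemma leq_pair_coder (a b : nat) : b <= pair_code a b.
Proof. by have := Cantor.to_nat_non_decreasing a b; rewrite /pair_code; lia. Qed.

Definition computable (f : nat -> nat) : Prop :=
  exists c, forall x, eval c x (f x).

Lemma computable_ext (f g : nat -> nat) : f =1 g -> computable f -> computable g.
Proof. by move=> fg [c cP]; exists c => x; rewrite -fg. Qed.

Lemma computable_comp (h f : nat -> nat) :
  computable h -> computable f -> computable (fun x => h (f x)).
Proof. by move=> [c cP] [d dP]; exists (Comp c d) => x /=; exists (f x). Qed.

Lemma computable_pair (f g : nat -> nat) :
  computable f -> computable g -> computable (fun x => pair_code (f x) (g x)).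
Proof.
by move=> [c cP] [d dP]; exists (Pair c d) => x /=; exists (f x), (g x).
Qed.

Lemma computable_comp2 (h : nat -> nat -> nat) (f g : nat -> nat) :
  computable (fun p => h (unpair p).1 (unpair p).2) ->
  computable f -> computable g -> computable (fun x => h (f x) (g x)).
Proof.
move=> hc fc gc; have := computable_comp hc (computable_pair fc gc).
by apply: computable_ext => x; rewrite pair_codeK.
Qed.

Lemma computable_fst (f : nat -> nat) :
  computable f -> computable (fun x => (unpair (f x)).1).
Proof. by apply: (computable_comp (h := fun p => (unpair p).1)); exists Fst. Qed.

Lemma computable_snd (f : nat -> nat) :
  computable f -> computable (fun x => (unpair (f x)).2).
Proof. by apply: (computable_comp (h := fun p => (unpair p).2)); exists Snd. Qed.

Lemma computable_succ (f : nat -> nat) :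
  computable f -> computable (fun x => (f x).+1).
Proof. by apply: (computable_comp (h := succn)); exists Succ. Qed.

Lemma computable_id : computable (fun x => x).
Proof.
by exists (Pair Fst Snd) => x /=; exists (unpair x).1, (unpair x).2; rewrite unpairK.
Qed.

Fixpoint const_code (a : nat) : code :=
  if a is a'.+1 then Comp Succ (const_code a') else Zero.

Lemma eval_const_code (a x : nat) : eval (const_code a) x a.
Proof. by elim: a => //= a IHa; exists a. Qed.

Lemma computable_const (a : nat) : computable (fun _ => a).
Proof. by exists (const_code a) => x; apply: eval_const_code. Qed.

Fixpoint prec (f g : nat -> nat) (a n : nat) : nat :=
  if n is n'.+1 then g (pair_code a (pair_code n' (prec f g a n'))) else f a.

Lemma computable_prec (f g h1 h2 : nat -> nat) :
  computable f -> computable g -> computable h1 -> computable h2 ->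
  computable (fun x => prec f g (h1 x) (h2 x)).
Proof.
move=> [c cP] [d dP]; apply: computable_comp2; exists (Prec c d) => x /=.
by elim: (unpair x).2 => //= n IHn; eexists; [exact: IHn|].
Qed.

(** The step of a primitive recursion sees the counter as well as the previous value; returning the
    counter gives the predecessor. *)
Lemma computable_pred (f : nat -> nat) :
  computable f -> computable (fun x => (f x).-1).
Proof.
move=> fc; apply: (computable_comp (h := predn)) fc.
have := computable_prec (computable_const 0)
  (computable_fst (computable_snd computable_id))
  (computable_const 0) computable_id.
by apply: computable_ext => -[|x] //=; rewrite !pair_codeK.
Qed.

Lemma computable_add (f g : nat -> nat) :
  computable f -> computable g -> computable (fun x => f x + g x).
Proof.
move=> fc gc; have := computable_prec computable_id
  (computable_succ (computable_snd (computable_snd computable_id))) fc gc.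
apply: computable_ext => x; elim: (g x) => [|n IHn] /=; first by rewrite addn0.
by rewrite !pair_codeK /= IHn addnS.
Qed.

Lemma computable_sub (f g : nat -> nat) :
  computable f -> computable g -> computable (fun x => f x - g x).
Proof.
move=> fc gc; have := computable_prec computable_id
  (computable_pred (computable_snd (computable_snd computable_id))) fc gc.
apply: computable_ext => x; elim: (g x) => [|n IHn] /=; first by rewrite subn0.
by rewrite !pair_codeK /= IHn subnS.
Qed.

Lemma computable_mul (f g : nat -> nat) :
  computable f -> computable g -> computable (fun x => f x * g x).
Proof.
move=> fc gc; have := computable_prec (computable_const 0)
  (computable_add (computable_fst computable_id)
     (computable_snd (computable_snd computable_id))) fc gc.
apply: computable_ext => x; elim: (g x) => [|n IHn] /=; first by rewrite muln0.
by rewrite !pair_codeK /= IHn mulnS.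
Qed.

Lemma computable_exp (f g : nat -> nat) :
  computable f -> computable g -> computable (fun x => f x ^ g x).
Proof.
move=> fc gc; have := computable_prec (computable_const 1)
  (computable_mul (computable_fst computable_id)
     (computable_snd (computable_snd computable_id))) fc gc.
apply: computable_ext => x; elim: (g x) => [|n IHn] //=.
by rewrite !pair_codeK /= IHn expnS.
Qed.

Ltac computability :=
  repeat lazymatch goal with
  | |- computable (fun x => x) => exact: computable_id
  | |- computable (fun _ => ?c) => exact: (computable_const c)
  | |- computable (fun x => (unpair _).1) => apply: computable_fst
  | |- computable (fun x => (unpair _).2) => apply: computable_snd
  | |- computable (fun x => _.+1) => apply: computable_succ
  | |- computable (fun x => _.-1) => apply: computable_pred
  | |- computable (fun x => pair_code _ _) => apply: computable_pair
  | |- computable (fun x => _ + _) => apply: computable_add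
  | |- computable (fun x => _ - _) => apply: computable_sub
  | |- computable (fun x => _ * _) => apply: computable_mul
  | |- computable (fun x => _ ^ _) => apply: computable_exp
  | H : computable ?f |- computable (fun x => ?f _) => apply: (computable_comp H)
  end.

Lemma computable_sum (F : nat -> nat -> nat) (f g : nat -> nat) :
  computable (fun p => F (unpair p).1 (unpair p).2) ->
  computable f -> computable g -> computable (fun x => \sum_(i < g x) F (f x) i).
Proof.
move=> Fc fc gc.
have stepc : computable (fun z => (unpair (unpair z).2).2 +
    F (unpair z).1 (unpair (unpair z).2).1).
  by apply: computable_add; [|apply: (computable_comp2 Fc)]; computability.
apply: computable_ext (computable_prec (computable_const 0) stepc fc gc) => x.
elim: (g x) => [|n IHn] /=; first by rewrite big_ord0.
by rewrite !pair_codeK /= IHn big_ord_recr.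
Qed.

Lemma computable_prod (F : nat -> nat -> nat) (f g : nat -> nat) :
  computable (fun p => F (unpair p).1 (unpair p).2) ->
  computable f -> computable g -> computable (fun x => \prod_(i < g x) F (f x) i).
Proof.
move=> Fc fc gc.
have stepc : computable (fun z => (unpair (unpair z).2).2 *
    F (unpair z).1 (unpair (unpair z).2).1).
  by apply: computable_mul; [|apply: (computable_comp2 Fc)]; computability.
apply: computable_ext (computable_prec (computable_const 1) stepc fc gc) => x.
elim: (g x) => [|n IHn] /=; first by rewrite big_ord0.
by rewrite !pair_codeK /= IHn big_ord_recr.
Qed.

(** Witnesses are zeros of a total computable function, so that conjunction becomes a sum over
    paired witnesses, and disjunction a product. *)
Definition semidec (P : nat -> Prop) : Prop :=
  exists2 f, computable f & forall x, P x <-> exists s, f (pair_code x s) = 0.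

Lemma semidec_ext (P Q : nat -> Prop) :
  (forall x, P x <-> Q x) -> semidec P -> semidec Q.
Proof. by move=> PQ [f fc fP]; exists f => // x; rewrite -PQ fP. Qed.

Lemma semidec_comp (P : nat -> Prop) (f : nat -> nat) :
  semidec P -> computable f -> semidec (fun x => P (f x)).
Proof.
move=> [g gc gP] fc.
exists (fun z => g (pair_code (f (unpair z).1) (unpair z).2)).
  by computability.
by move=> x; rewrite gP; split=> -[s gs]; exists s; rewrite pair_codeK in gs *.
Qed.

Lemma semidec_comp2 (P : nat -> nat -> Prop) (f g : nat -> nat) :
  semidec (fun p => P (unpair p).1 (unpair p).2) ->
  computable f -> computable g -> semidec (fun x => P (f x) (g x)).
Proof.
move=> Pc fc gc; have := semidec_comp Pc (computable_pair fc gc).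
by apply: semidec_ext => x; rewrite pair_codeK.
Qed.

Lemma semidec_and (P Q : nat -> Prop) :
  semidec P -> semidec Q -> semidec (fun x => P x /\ Q x).
Proof.
move=> [f fc fP] [g gc gP].
exists (fun z => f (pair_code (unpair z).1 (unpair (unpair z).2).1) +
                 g (pair_code (unpair z).1 (unpair (unpair z).2).2)).
  by computability.
move=> x; rewrite fP gP; split=> [[[s fs] [t gt]]|[s]].
  by exists (pair_code s t); rewrite !pair_codeK /= fs gt.
rewrite pair_codeK /= => /eqP; rewrite addn_eq0 => /andP[/eqP fs /eqP gs].
by split; eexists; eassumption.
Qed.

Lemma semidec_or (P Q : nat -> Prop) :
  semidec P -> semidec Q -> semidec (fun x => P x \/ Q x).
Proof.
move=> [f fc fP] [g gc gP]; exists (fun z => f z * g z); first by computability.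
move=> x; rewrite fP gP; split=> [[] [s fs]|[s /eqP]].
- by exists s; rewrite fs.
- by exists s; rewrite fs muln0.
- by rewrite muln_eq0 => /orP[] /eqP fs; [left|right]; exists s.
Qed.

Lemma semidec_ex (P : nat -> nat -> Prop) :
  semidec (fun p => P (unpair p).1 (unpair p).2) ->
  semidec (fun x => exists y, P x y).
Proof.
move=> [f fc fP].
exists (fun z => f (pair_code (pair_code (unpair z).1 (unpair (unpair z).2).1)
                              (unpair (unpair z).2).2)); first by computability.
have {}fP x y : P x y <-> exists s, f (pair_code (pair_code x y) s) = 0.
  by rewrite -fP pair_codeK.
move=> x; split=> [[y /fP[s fs]]|[s]].
  by exists (pair_code y s); rewrite !pair_codeK.
by rewrite pair_codeK /= => fs; exists (unpair s).1; apply/fP; eexists; eassumption.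
Qed.

(** Finitely many witnesses have a common bound [B]. The product over [s < B] vanishes when some
    witness lies below [B], and the sum of these products over [y] vanishes when this happens for
    every [y]. *)
Lemma semidec_ball (P : nat -> nat -> Prop) (g : nat -> nat) :
  semidec (fun p => P (unpair p).1 (unpair p).2) -> computable g ->
  semidec (fun x => forall y, y < g x -> P x y).
Proof.
move=> [f fc fP] gc.
have {}fP x y : P x y <-> exists s, f (pair_code (pair_code x y) s) = 0.
  by rewrite -fP pair_codeK.
pose h z y := \prod_(s < (unpair z).2) f (pair_code (pair_code (unpair z).1 y) s).
exists (fun z => \sum_(y < g (unpair z).1) h z y).
  apply: computable_sum; [|by computability..].
  apply: (computable_prod (F := fun z s => f (pair_code z s))
     (f := fun p => pair_code (unpair (unpair p).1).1 (unpair p).2)); by computability.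
have hP x B y : h (pair_code x B) y = 0 <->
    exists2 s, s < B & f (pair_code (pair_code x y) s) = 0.
  rewrite /h pair_codeK /=; split=> [/eqP|[s sB fs]].
    by rewrite prod_nat_seq_eq0 => /hasP[s _ /eqP fs]; exists s.
  apply/eqP; rewrite prod_nat_seq_eq0; apply/hasP.
    by exists (Ordinal sB); [apply: mem_index_enum|apply/eqP].
move=> x; split=> [Px|[B]]; last first.
  rewrite pair_codeK /= => /eqP; rewrite sum_nat_eq0 => /forallP h0 y yg.
  have /eqP/hP[s _ fs] := h0 (Ordinal yg).
  by apply/fP; exists s.
have [B BP] : exists B, forall y, y < g x -> h (pair_code x B) y = 0.
  elim: (g x) Px => [|m IHm] Px; first by exists 0.
  have [B BP] : exists B, forall y, y < m -> h (pair_code x B) y = 0.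
    by apply: IHm => y ym; apply: Px; apply: ltnW.
  have /fP[s fs] := Px m (leqnn _).
  exists (maxn B s.+1) => y; rewrite ltnS leq_eqVlt => /orP[/eqP->|ym].
    by apply/hP; exists s => //; rewrite leq_maxr.
  have /hP[t tB ft] := BP _ ym.
  by apply/hP; exists t => //; rewrite (leq_trans tB) ?leq_maxl.
exists B; rewrite pair_codeK /=; apply/eqP; rewrite sum_nat_eq0.
by apply/forallP => y; apply/eqP/BP.
Qed.

Lemma semidec_leq (f g : nat -> nat) :
  computable f -> computable g -> semidec (fun x => f x <= g x).
Proof.
move=> fc gc; exists (fun z => f (unpair z).1 - g (unpair z).1).
  by computability.
move=> x; split=> [fg|[s]]; last by rewrite pair_codeK => /eqP.
by exists 0; apply/eqP; rewrite pair_codeK.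
Qed.

Lemma semidec_eq (f g : nat -> nat) :
  computable f -> computable g -> semidec (fun x => f x = g x).
Proof.
move=> fc gc.
apply: semidec_ext (semidec_and (semidec_leq fc gc) (semidec_leq gc fc)) => x.
by split=> [[fg gf]|->] //; apply/eqP; rewrite eqn_leq fg.
Qed.

Ltac semidecidability :=
  repeat lazymatch goal with
  | |- semidec (fun x => _ /\ _) => apply: semidec_and
  | |- semidec (fun x => _ \/ _) => apply: semidec_or
  | |- semidec (fun x => exists y, _) => apply: semidec_ex
  | |- semidec (fun x => forall y, is_true (y < _) -> _) => apply: semidec_ball
  | |- semidec (fun x => is_true (_ <= _)) => apply: semidec_leq
  | |- semidec (fun x => _ = _) => apply: semidec_eq
  | H : semidec ?P |- semidec (fun x => ?P _) => apply: (semidec_comp H)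
  end; computability.

(** * Binary digits and canonical indices of finite sets *)

Definition bit (m i : nat) : bool := odd (m %/ 2 ^ i).

Lemma mem_Delta (m i : nat) : (i \in Delta m) = bit m i.
Proof.
rewrite mem_filter mem_iota add0n andbC leq0n /=.
case: ltnP => // mi; rewrite /bit divn_small //.
exact: leq_ltn_trans mi (ltn_expl i _).
Qed.

Lemma bit_ltn (m i : nat) : bit m i -> i < m.
Proof. by rewrite -mem_Delta mem_filter mem_iota => /andP[_]. Qed.

(** Division is traded for an existential formula in sums, products and powers, which
    [semidecidability] can treat. Allowing both values of [b] makes the absence of a digit
    semi-decidable as well. *)
Lemma bitP (m i : nat) (b : bool) :
  bit m i = b <-> exists q r, m = (q * 2 + b) * 2 ^ i + r /\ r.+1 <= 2 ^ i.
Proof.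
have e0 : 0 < 2 ^ i by rewrite expn_gt0.
split=> [<-|[q [r [-> ri]]]].
  exists (m %/ 2 ^ i)./2, (m %% 2 ^ i); split; last exact: ltn_pmod.
  by rewrite muln2 [_ + bit _ _]addnC odd_double_half -divn_eq.
by rewrite /bit divnMDl // divn_small // addn0 oddD oddM andbF oddb.
Qed.

(** The digits are written from the least significant one: [P 0] is the last digit, and the
    induction hypothesis for the shifted predicate gives the others. No computability of [P] is
    assumed, so any bounded set is covered. *)
Lemma finite_Delta (P : pred nat) (N : nat) :
  exists m, forall i, bit m i = (i < N) && P i.
Proof.
elim: N P => [|N IHN] P; first by exists 0 => i; rewrite /bit div0n.
have [m mP] := IHN (fun i => P i.+1).
exists (P 0 + m.*2) => -[|i].
  by rewrite /bit divn1 oddD odd_double addbF oddb.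
by rewrite /bit expnS divnMA divn2 half_bit_double -/(bit _ _) mP.
Qed.

Lemma finite_seq_Delta (s : seq nat) : exists m, forall i, bit m i = (i \in s).
Proof.
have [m mP] := finite_Delta (mem s) (\max_(j <- s) j).+1.
exists m => i; rewrite mP; apply: andb_idl => /= si.
by rewrite ltnS; apply: (leq_bigmax_seq (F := id)).
Qed.

Lemma semidec_bit (f g : nat -> nat) (b : bool) :
  computable f -> computable g -> semidec (fun x => bit (f x) (g x) = b).
Proof.
move=> fc gc; apply: semidec_ext (fun x => iff_sym (bitP _ _ _)) _.
by semidecidability.
Qed.

(** * Semi-decidability of inductively derived facts *)

Inductive derivable (A : nat -> Prop) (R : nat -> nat -> nat -> Prop) :
  nat -> Prop :=
| derivable_axiom a : A a -> derivable A R a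
| derivable_rule b1 b2 a :
    derivable A R b1 -> derivable A R b2 -> R b1 b2 a -> derivable A R a.

(* A derivation is coded as a finite set of pairs (rank, fact), each fact being
   an axiom or the conclusion of a rule with premises of smaller rank. *)
Lemma derivable_certificate (A : nat -> Prop) (R : nat -> nat -> nat -> Prop) x :
  derivable A R x <-> exists D k, bit D (pair_code k x) = true /\
    forall w, w < D -> bit D w = false \/ A (unpair w).2 \/
      exists k1 b1 k2 b2, k1 < (unpair w).1 /\ k2 < (unpair w).1 /\
        bit D (pair_code k1 b1) = true /\ bit D (pair_code k2 b2) = true /\
        R b1 b2 (unpair w).2.
Proof.
split=> [|[D [k [Dx DP]]]]; last first.
  (* Premises have smaller rank, so strong induction on the rank rebuilds the derivation and rules
     out circular justifications. *)
  elim/ltn_ind: k x Dx => k IHk x Dx.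
  have /DP := bit_ltn Dx; rewrite Dx pair_codeK /= => -[//|[|]].
    exact: derivable_axiom.
  move=> [k1 [b1 [k2 [b2 [k1k [k2k [Db1 [Db2]]]]]]]].
  by apply: derivable_rule; [apply: IHk Db1|apply: IHk Db2].
pose derives (s : seq nat) w := A (unpair w).2 \/
  exists k1 b1 k2 b2, [/\ k1 < (unpair w).1, k2 < (unpair w).1,
    pair_code k1 b1 \in s, pair_code k2 b2 \in s & R b1 b2 (unpair w).2].
have derives_sub s t w : {subset s <= t} -> derives s w -> derives t w.
  move=> st [Aw|[k1 [b1 [k2 [b2 [? ? /st ? /st ? ?]]]]]]; [by left|right].
  by exists k1, b1, k2, b2.
(* Certificates are first built as lists, which are easy to concatenate, and encoded as a number
   only at the end. *)
suff H : derivable A R x -> exists s k, pair_code k x \in s /\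
    forall w, w \in s -> derives s w.
  move=> /H[s [k [sx sP]]]; have [D DP] := finite_seq_Delta s.
  exists D, k; rewrite DP; split=> // w _; rewrite DP.
  case: (boolP (w \in s)) => [/sP ws|_]; [right|by left].
  case: ws => [Aw|[k1 [b1 [k2 [b2 [? ? ? ? ?]]]]]]; [by left|right].
  by exists k1, b1, k2, b2; rewrite !DP; do !split.
elim=> {x} [a Aa|b1 b2 a _ [s1 [k1 [sb1 sP1]]] _ [s2 [k2 [sb2 sP2]]] Ra].
  exists [:: pair_code 0 a], 0; rewrite inE eqxx; split=> // w.
  by rewrite inE => /eqP->; left; rewrite pair_codeK.
(* The two certificates are merged with their ranks unchanged, and the conclusion receives a rank
   above both premises. *)
pose s := pair_code (maxn k1 k2).+1 a :: s1 ++ s2.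
have s1s : {subset s1 <= s} by move=> w ws; rewrite inE mem_cat ws orbT.
have s2s : {subset s2 <= s} by move=> w ws; rewrite inE mem_cat ws !orbT.
exists s, (maxn k1 k2).+1; rewrite mem_head; split=> // w.
rewrite inE mem_cat => /orP[/eqP->|/orP[/sP1|/sP2]]; last 2 first.
- exact: derives_sub.
- exact: derives_sub.
right; exists k1, b1, k2, b2; rewrite pair_codeK !ltnS leq_maxl leq_maxr.
by split=> //; [apply: s1s|apply: s2s].
Qed.

(** The certificates of [derivable_certificate] are searched for. Axioms and rules depend on a
    parameter, the first component of the input, which makes the search uniform. *)
Lemma semidec_derivable (A : nat -> nat -> Prop)
    (R : nat -> nat -> nat -> nat -> Prop) :
  semidec (fun z => A (unpair z).1 (unpair z).2) ->
  semidec (fun z => R (unpair z).1 (unpair (unpair z).2).1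
    (unpair (unpair (unpair z).2).2).1 (unpair (unpair (unpair z).2).2).2) ->
  semidec (fun z => derivable (A (unpair z).1) (R (unpair z).1) (unpair z).2).
Proof.
move=> Ac Rc.
have {}Ac f g : computable f -> computable g -> semidec (fun z => A (f z) (g z)).
  exact: semidec_comp2.
have {}Rc f g h k : computable f -> computable g -> computable h ->
    computable k -> semidec (fun z => R (f z) (g z) (h z) (k z)).
  move=> fc gc hc kc.
  have := semidec_comp Rc
    (computable_pair fc (computable_pair gc (computable_pair hc kc))).
  by apply: semidec_ext => z; rewrite !pair_codeK.
apply: semidec_ext (fun z => iff_sym (derivable_certificate _ _ _)) _.
apply: semidec_ex; apply: semidec_ex; apply: semidec_and.
  by apply: semidec_bit; computability.
apply: semidec_ball; last by computability.
apply: semidec_or; first by apply: semidec_bit; computability.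
apply: semidec_or; first by apply: Ac; computability.
do 4 apply: semidec_ex.
do ![apply: semidec_and]; try (by apply: semidec_leq; computability).
- by apply: semidec_bit; computability.
- by apply: semidec_bit; computability.
- by apply: Rc; computability.
Qed.

(** * Universality and parametrization *)

(** The constants are numbered below 4, and the remainder modulo 4 of a larger number determines the
    outermost constructor. *)
Lemma godel_inj : injective godel.
Proof.
elim=> [||||f IHf g IHg|f IHf g IHg|f IHf g IHg|f IHf]
  [||||f' g'|f' g'|f' g'|f'] //= e; try (exfalso; lia).
- have /pair_code_inj[/IHf-> /IHg->] //:
    pair_code (godel f) (godel g) = pair_code (godel f') (godel g') by lia.
- have /pair_code_inj[/IHf-> /IHg->] //:
    pair_code (godel f) (godel g) = pair_code (godel f') (godel g') by lia.
- have /pair_code_inj[/IHf-> /IHg->] //: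
    pair_code (godel f) (godel g) = pair_code (godel f') (godel g') by lia.
- by rewrite (IHf f') //; lia.
Qed.

(** Strong induction applies because the components of a pair are bounded by its code, which is
    smaller than [m]. *)
Lemma godel_surj (m : nat) : exists c, godel c = m.
Proof.
elim/ltn_ind: m => m IHm.
have [m4|m4] := ltnP m 4.
  by case: m m4 {IHm} => [|[|[|[|]]]] // _;
    [exists Zero|exists Succ|exists Fst|exists Snd].
have me : m = 4 * ((m - 4) %/ 4) + 4 + (m - 4) %% 4 by lia.
move: ((m - 4) %% 4) (ltn_pmod (m - 4) (isT : 0 < 4)) me => r r4 me.
move: ((m - 4) %/ 4) me => k me; rewrite -(unpairK k) in me.
have [|f fP] := IHm (unpair k).1.
  by have := leq_pair_codel (unpair k).1 (unpair k).2; lia.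
have [|g gP] := IHm (unpair k).2.
  by have := leq_pair_coder (unpair k).1 (unpair k).2; lia.
have [|h hP] := IHm k; first by rewrite unpairK in me; lia.
case: r r4 me => [|[|[|[|]]]] // _ ->.
- by exists (Pair f g); rewrite /= fP gP addn0.
- by exists (Comp f g); rewrite /= fP gP -addnA.
- by exists (Prec f g); rewrite /= fP gP -addnA.
- by exists (Mu h); rewrite /= hP unpairK -addnA.
Qed.

Lemma eval_Prec0 (f g : code) (x y : nat) :
  eval (Prec f g) (pair_code x 0) y <-> eval f x y.
Proof. by rewrite /= pair_codeK. Qed.

Lemma eval_PrecS (f g : code) (x n y : nat) :
  eval (Prec f g) (pair_code x n.+1) y <->
  exists2 r, eval (Prec f g) (pair_code x n) r &
             eval g (pair_code x (pair_code n r)) y.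
Proof. by rewrite /= !pair_codeK. Qed.

(** * Evaluation of codes as a derivation system *)

Definition fact (t x y z : nat) : nat :=
  pair_code t (pair_code x (pair_code y z)).

Lemma fact_inj (t x y z t' x' y' z' : nat) :
  fact t x y z = fact t' x' y' z' -> [/\ t = t', x = x', y = y' & z = z'].
Proof. by move=> /pair_code_inj[-> /pair_code_inj[-> /pair_code_inj[-> ->]]]. Qed.

(* [fact 0 f x y] says that phi_f(x) = y, and [fact 1 f x y] that phi_f<x, z>
   is defined and nonzero for all z < y. *)
Definition eval_axiom (a : nat) : Prop :=
  (exists x, a = fact 0 0 x 0) \/
  (exists x, a = fact 0 1 x x.+1) \/
  (exists x, a = fact 0 2 x (unpair x).1) \/
  (exists x, a = fact 0 3 x (unpair x).2) \/
  (exists f x, a = fact 1 f x 0).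

Definition eval_rule (b1 b2 a : nat) : Prop :=
  (exists f g x u v, b1 = fact 0 f x u /\ b2 = fact 0 g x v /\
     a = fact 0 (4 * pair_code f g + 4) x (pair_code u v)) \/
  (exists f g x u y, b1 = fact 0 g x u /\ b2 = fact 0 f u y /\
     a = fact 0 (4 * pair_code f g + 5) x y) \/
  (exists f g x y, b1 = fact 0 f x y /\
     a = fact 0 (4 * pair_code f g + 6) (pair_code x 0) y) \/
  (exists f g x n r y, b1 = fact 0 (4 * pair_code f g + 6) (pair_code x n) r /\
     b2 = fact 0 g (pair_code x (pair_code n r)) y /\
     a = fact 0 (4 * pair_code f g + 6) (pair_code x n.+1) y) \/
  (exists f x y v, b1 = fact 1 f x y /\ b2 = fact 0 f (pair_code x y) v.+1 /\
     a = fact 1 f x y.+1) \/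
  (exists f x y, b1 = fact 1 f x y /\ b2 = fact 0 f (pair_code x y) 0 /\
     a = fact 0 (4 * f + 7) x y).

(** Both tags go through one induction: minimization draws a fact of tag 0 from one of tag 1, and
    facts of tag 1 are extended by facts of tag 0. *)
Lemma eval_derivable_sound (a : nat) : derivable eval_axiom eval_rule a ->
  forall t c x y, a = fact t (godel c) x y ->
  if t is 0 then eval c x y
  else forall z, z < y -> exists v, eval c (pair_code x z) v.+1.
Proof.
have pairI c f g r : 4 <= r < 7 -> godel c = 4 * pair_code f g + r ->
    exists c1 c2, [/\ godel c1 = f, godel c2 = g &
      c = if r is 4 then Pair c1 c2 else if r is 5 then Comp c1 c2 else Prec c1 c2].
  case: r => [|[|[|[|[|[|[|]]]]]]] // _;
    case: c => [||||c1 c2|c1 c2|c1 c2|c1] /= e; try (exfalso; lia);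
    have /pair_code_inj[<- <-] : pair_code (godel c1) (godel c2) = pair_code f g
      by lia.
  - by exists c1, c2.
  - by exists c1, c2.
  - by exists c1, c2.
elim=> {a} [a + t c x y aE|b1 b2 a _ IH1 _ IH2 + t c x y aE].
  rewrite {}aE => -[|[|[|[|]]]].
  - by move=> [x' /fact_inj[-> /(@godel_inj _ Zero)-> _ ->]].
  - by move=> [x' /fact_inj[-> /(@godel_inj _ Succ)-> -> ->]].
  - by move=> [x' /fact_inj[-> /(@godel_inj _ Fst)-> -> ->]].
  - by move=> [x' /fact_inj[-> /(@godel_inj _ Snd)-> -> ->]].
  - by move=> [f [x' /fact_inj[-> _ _ ->]]].
rewrite {}aE => -[|[|[|[|[|]]]]].
- move=> [f [g [x' [u [v [e1 [e2 /fact_inj[-> + -> ->]]]]]]]].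
  move=> /pairI[] // c1 [c2 [c1f c2g ->]] /=; exists u, v; split=> //.
    by apply: (IH1 0); rewrite c1f.
  by apply: (IH2 0); rewrite c2g.
- move=> [f [g [x' [u [y' [e1 [e2 /fact_inj[-> + -> ->]]]]]]]].
  move=> /pairI[] // c1 [c2 [c1f c2g ->]] /=; exists u.
    by apply: (IH1 0); rewrite c2g.
  by apply: (IH2 0); rewrite c1f.
- move=> [f [g [x' [y' [e1 /fact_inj[-> + -> ->]]]]]].
  move=> /pairI[] // c1 [c2 [c1f c2g ->]]; apply/eval_Prec0.
  by apply: (IH1 0); rewrite c1f.
- move=> [f [g [x' [n [r [y' [e1 [e2 /fact_inj[-> + -> ->]]]]]]]]].
  move=> ce; have /pairI[//|c1 [c2 [c1f c2g cE]]] := ce.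
  rewrite cE; apply/eval_PrecS; exists r.
    by rewrite -cE; apply: (IH1 0); rewrite ce.
  by apply: (IH2 0); rewrite c2g.
- move=> [f [x' [y' [v [e1 [e2 /fact_inj[-> fE -> ->]]]]]]] z.
  rewrite ltnS leq_eqVlt => /orP[/eqP->|zy].
    by exists v; apply: (IH2 0); rewrite fE.
  by apply: (IH1 1 _ _ _ _ z zy); rewrite fE.
- move=> [f [x' [y' [e1 [e2 /fact_inj[-> + -> ->]]]]]].
  case: c => [||||c1 c2|c1 c2|c1 c2|c] /= ce; try (exfalso; lia).
  have cf : godel c = f by lia.
  split; first by apply: (IH2 0); rewrite cf.
  by apply: (IH1 1); rewrite cf.
Qed.

Lemma eval_derivable_complete (c : code) (x y : nat) :
  eval c x y -> derivable eval_axiom eval_rule (fact 0 (godel c) x y).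
Proof.
elim: c x y => [||||f IHf g IHg|f IHf g IHg|f IHf g IHg|f IHf] x y.
- by move=> ->; apply: derivable_axiom; left; exists x.
- by move=> ->; apply: derivable_axiom; right; left; exists x.
- by move=> ->; apply: derivable_axiom; do 2 right; left; exists x.
- by move=> ->; apply: derivable_axiom; do 3 right; left; exists x.
- move=> [u [v [/IHf cu /IHg cv ->]]]; apply: derivable_rule cu cv _.
  by left; exists (godel f), (godel g), x, u, v.
- move=> [u /IHg cu /IHf cy]; apply: derivable_rule cu cy _.
  by right; left; exists (godel f), (godel g), x, u, y.
- rewrite -(unpairK x); move: (unpair x).1 (unpair x).2 => {}x n.
  elim: n y => [|n IHn] y.
    (* This rule constrains only its first premise, so the same derivation fills both places. *)
    move=> /eval_Prec0/IHf cy; apply: (derivable_rule cy cy); do 2 right; left.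
    by exists (godel f), (godel g), x, y.
  move=> /eval_PrecS[r /IHn cr /IHg cy]; apply: derivable_rule cr cy _.
  by do 3 right; left; exists (godel f), (godel g), x, n, r, y.
- move=> [/IHf c0 cS].
  have {}cS : derivable eval_axiom eval_rule (fact 1 (godel f) x y).
    elim: y cS {c0} => [_|y IHy cS].
      by apply: derivable_axiom; do 4 right; exists (godel f), x.
    have [v /IHf cv] := cS y (leqnn _).
    apply: (derivable_rule (IHy _) cv) => [z zy|]; first by apply: cS; apply: ltnW.
    by do 4 right; left; exists (godel f), x, y, v.
  by apply: derivable_rule cS c0 _; do 5 right; exists (godel f), x, y.
Qed.

Lemma phi_derivable (i x y : nat) :
  phi i x y <-> derivable eval_axiom eval_rule (fact 0 i x y).
Proof.
split=> [[c <-]|H]; first exact: eval_derivable_complete.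
have [c cP] := godel_surj i; exists c => //.
by apply: (eval_derivable_sound H (t := 0)); rewrite cP.
Qed.

Lemma semidec_W (f g : nat -> nat) :
  computable f -> computable g -> semidec (fun x => W (f x) (g x)).
Proof.
move=> fc gc; apply: semidec_ex.
apply: semidec_ext (fun z => iff_sym (phi_derivable _ _ _)) _.
have cl : semidec (fun z => derivable eval_axiom eval_rule (unpair z).2).
  apply: (semidec_derivable (A := fun _ => eval_axiom) (R := fun _ => eval_rule)).
    by rewrite /eval_axiom /fact; semidecidability.
  by rewrite /eval_rule /fact; semidecidability.
apply: (semidec_comp2 (P := fun _ => derivable eval_axiom eval_rule) cl
  computable_id).
by rewrite /fact; computability.
Qed.

(** Minimization runs over pairs of a candidate [y] and a witness that [P x y] holds; [Fst] then
    returns the candidate. *)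
Lemma search_semidec (P : nat -> nat -> Prop) :
  semidec (fun p => P (unpair p).1 (unpair p).2) ->
  exists c, (forall x y, eval c x y -> P x y) /\
    (forall x, (exists y, P x y) -> exists y, eval c x y).
Proof.
move=> [f fc fP]; have {}fP x y : P x y <->
    exists s, f (pair_code (pair_code x y) s) = 0 by rewrite -fP pair_codeK.
pose h z := f (pair_code (pair_code (unpair z).1 (unpair (unpair z).2).1)
                         (unpair (unpair z).2).2).
have [c cP] : computable h by rewrite /h; computability.
exists (Comp Fst (Mu c)); split=> [x y [t [ct _] /= ->]|x [y /fP[s fs]]].
  apply/fP; exists (unpair t).2.
  have := eval_functional ct (cP _).
  by rewrite /h pair_codeK.
have ex : exists t, h (pair_code x t) == 0.
  by exists (pair_code y s); rewrite /h !pair_codeK /= fs.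
case: (ex_minnP ex) => t /eqP ht tmin.
exists (unpair t).1, t => //; split=> [|z zt]; first by rewrite -ht; apply: cP.
(* [Mu] requires the earlier values to be successors; the minimality of [t] makes them nonzero. *)
exists (h (pair_code x z)).-1; rewrite prednK; first exact: cP.
by rewrite lt0n; apply: contraL zt => /tmin; rewrite -leqNgt.
Qed.

(** The parameter is hard-wired as [const_code a] in a search for a witness, and the number of the
    resulting code is a computable function of [a]. *)
Lemma smn (P : nat -> nat -> Prop) :
  semidec (fun p => P (unpair p).1 (unpair p).2) ->
  exists2 s, computable s & forall a, W (s a) = P a.
Proof.
move=> [f [c cP] fP].
pose d a := Mu (Comp c (Pair (Pair (const_code a) Fst) Snd)).
exists (fun a => godel (d a)).
  have cst : computable (fun a => godel (const_code a)).
    (* Here [1] is [godel Succ] and [4 * _ + 5] numbers a composition, so each step composes with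
       [Succ]. *)
    have stepc : computable (fun z => 4 * pair_code 1 (unpair (unpair z).2).2 + 5).
      by computability.
    apply: computable_ext (computable_prec (computable_const 0) stepc
      (computable_const 0) computable_id) => x.
    by elim: x => //= x IHx; rewrite !pair_codeK /= IHx.
  by rewrite /d /=; computability.
have dP a x s : eval (Comp c (Pair (Pair (const_code a) Fst) Snd))
    (pair_code x s) (f (pair_code (pair_code a x) s)).
  exists (pair_code (pair_code a x) s) => //=; exists (pair_code a x), s.
  rewrite pair_codeK; split=> //; exists a, x; split=> //; exact: eval_const_code.
move=> a; rewrite predeqE => x; have -> : P a x <->
    exists s, f (pair_code (pair_code a x) s) = 0 by rewrite -fP pair_codeK.
split=> [[s [e /godel_inj->]] [es _]|[s fs]].
  by exists s; apply: eval_functional (dP a x s) es.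
have ex : exists t, f (pair_code (pair_code a x) t) == 0 by exists s; rewrite fs.
case: (ex_minnP ex) => t /eqP ft tmin.
exists t, (d a) => //; split=> [|z zt]; first by rewrite -ft; apply: dP.
exists (f (pair_code (pair_code a x) z)).-1; rewrite prednK; first exact: dP.
by rewrite lt0n; apply: contraL zt => /tmin; rewrite -leqNgt.
Qed.

(** Excluded middle and choice turn the graph of [c], single-valued by [eval_functional], into a
    function with values in [option]. *)
Lemma partial_computable_code (c : code) :
  exists2 F, partial_computable F & forall x y, F x = Some y <-> eval c x y.
Proof.
pose F x := if pselect (exists y, eval c x y) is left ex_y
  then Some (projT1 (cid ex_y)) else None.
suff FP x y : F x = Some y <-> eval c x y by exists F => //; exists c.
rewrite /F; case: pselect => [ex|nex]; last by split=> // cy; case: nex; exists y.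
case: cid => z /= cz; split=> [[<-] //|cy].
by rewrite (eval_functional cz cy).
Qed.

(** * The word problem of recursive presentations *)

(** For [d < 2 * n], the number of the word numbered [u] with the letter of digit [d] put in
    front. *)
Definition cons_code (n d u : nat) : nat := (u * (2 * n) + d).+1.

(** [theta] uses the number itself as fuel, so the tail of a word may be read with more fuel than it
    would receive on its own. *)
Lemma digits_rec_fuel (b f g m : nat) :
  m <= f -> m <= g -> digits_rec f b m = digits_rec g b m.
Proof.
elim: f g m => [|f IHf] [|g] [|m] //=; rewrite !ltnS => mf mg.
by congr (_ :: _); apply: IHf; apply: leq_trans (leq_div _ _) _.
Qed.

Lemma theta_cons (n u : nat) (a : letter n) :
  theta n (cons_code n (letter_digit a) u) = a :: theta n u.
Proof.
case: a => i e; have n0 : 0 < n by apply: leq_ltn_trans (ltn_ord i).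
have dl : letter_digit (i, e) < 2 * n.
  by rewrite /letter_digit; have := ltn_ord i; case: e => /=; lia.
rewrite /theta /= modnMDl modn_small // divnMDl ?muln_gt0 //.
have -> : digit_letter n (letter_digit (i, e)) = Some (i, e).
  rewrite /digit_letter /letter_digit /= half_bit_double.
  by rewrite valK /= oddD odd_double addbF oddb.
rewrite divn_small // addn0; congr (_ :: pmap _ _).
apply: digits_rec_fuel => //; apply: leq_trans (leq_addr _ _).
by rewrite leq_pmulr // muln_gt0.
Qed.

Lemma theta_invK (n : nat) : cancel (@theta_inv n) (theta n).
Proof.
elim=> [|a w IHw] //=.
by rewrite -[X in theta n X]/(cons_code _ _ _) theta_cons IHw.
Qed.

Lemma thetaK (n : nat) : 0 < n -> cancel (theta n) (@theta_inv n).
Proof. by move=> n0 k; apply: (bij_inj (theta_bij n0)); rewrite theta_invK. Qed.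

Lemma letter_digit_surj (n d : nat) :
  d < 2 * n -> exists a : letter n, letter_digit a = d.
Proof.
move=> dn; have hn : d./2 < n by rewrite ltn_half_double -mul2n.
by exists (Ordinal hn, odd d); apply: odd_double_half.
Qed.

(* [fact 0 u v 0] says that theta u and theta v are equal in the group, and
   [fact 1 u v w] that theta u ++ theta v = theta w. *)
Definition word_axiom (n a : nat) : Prop :=
  (exists u, a = fact 0 u u 0) \/
  (exists u i, i < n /\
     a = fact 0 (cons_code n (i * 2) (cons_code n (1 + i * 2) u)) u 0) \/
  (exists u i, i < n /\
     a = fact 0 (cons_code n (1 + i * 2) (cons_code n (i * 2) u)) u 0) \/
  (exists v, a = fact 1 0 v v).

(** Congruence is needed only for a letter on the left: cancellations and relators are already
    stated with an arbitrary tail on the right. Facts of tag 1 supply that tail for the relators. *)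
Definition word_rule (n j b1 b2 a : nat) : Prop :=
  (exists u v w, b1 = fact 0 u v 0 /\ b2 = fact 0 v w 0 /\ a = fact 0 u w 0) \/
  (exists u v, b1 = fact 0 u v 0 /\ a = fact 0 v u 0) \/
  (exists d u v, d < 2 * n /\ b1 = fact 0 u v 0 /\
     a = fact 0 (cons_code n d u) (cons_code n d v) 0) \/
  (exists d u v w, d < 2 * n /\ b1 = fact 1 u v w /\
     a = fact 1 (cons_code n d u) v (cons_code n d w)) \/
  (exists r v w, W j r /\ b1 = fact 1 r v w /\ a = fact 0 w v 0).

(** In the fact, the first [0] is the tag of equality, the second names the empty word, and the last
    is a filler. *)
Definition word_derivable (n j k : nat) : Prop :=
  derivable (word_axiom n) (word_rule n j) (fact 0 k 0 0).

Lemma semidec_word_derivable (f g h : nat -> nat) :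
  computable f -> computable g -> computable h ->
  semidec (fun x => word_derivable (f x) (g x) (h x)).
Proof.
move=> fc gc hc.
have dc := @semidec_derivable
  (fun p => word_axiom (unpair p).1) (fun p => word_rule (unpair p).1 (unpair p).2).
have {}dc := semidec_comp (dc _ _) (computable_pair (computable_pair fc gc)
   (computable_pair (computable_const 0) (computable_pair hc
   (computable_pair (computable_const 0) (computable_const 0))))).
apply: semidec_ext (dc _ _) => [x||]; first by rewrite !pair_codeK.
  by rewrite /word_axiom /fact /cons_code; semidecidability.
rewrite /word_rule /fact /cons_code; semidecidability.
by apply: semidec_W; computability.
Qed.

Section WordProblem.
Variables n j : nat.
Local Notation R := (theta n @` W j).
Local Notation D := (derivable (word_axiom n) (word_rule n j)).

Lemma word_derivable_sound (a : nat) : D a ->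
  forall t x y z, a = fact t x y z ->
  if t is 0 then pres_eq R (theta n x) (theta n y)
  else theta n z = theta n x ++ theta n y.
Proof.
elim=> {a} [a + t x y z aE|b1 b2 a _ IH1 _ IH2 + t x y z aE].
  rewrite {}aE => -[|[|[|]]].
  - by move=> [u /fact_inj[-> -> -> _]]; apply: pres_refl.
  - move=> [u [i [ni /fact_inj[-> -> -> _]]]].
    (* The digits [i * 2] and [1 + i * 2] belong to the generator [i] and its formal inverse. *)
    have := @theta_cons n _ (Ordinal ni, true).
    have := @theta_cons n _ (Ordinal ni, false).
    rewrite /letter_digit /= -muln2 add0n => -> ->.
    exact: (pres_cat (pres_cancel R (Ordinal ni, false)) (pres_refl R _)).
  - move=> [u [i [ni /fact_inj[-> -> -> _]]]].
    have := @theta_cons n _ (Ordinal ni, false).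
    have := @theta_cons n _ (Ordinal ni, true).
    rewrite /letter_digit /= -muln2 add0n => -> ->.
    exact: (pres_cat (pres_cancel R (Ordinal ni, true)) (pres_refl R _)).
  - by move=> [u /fact_inj[-> -> -> ->]].
rewrite {}aE => -[|[|[|[|]]]].
- move=> [u [v [w [e1 [e2 /fact_inj[-> -> -> _]]]]]].
  exact: pres_trans (IH1 0 _ _ _ e1) (IH2 0 _ _ _ e2).
- by move=> [u [v [e1 /fact_inj[-> -> -> _]]]]; apply/pres_sym/(IH1 0 _ _ _ e1).
- move=> [d [u [v [dn [e1 /fact_inj[-> -> -> _]]]]]].
  have [c <-] := letter_digit_surj dn; rewrite !theta_cons.
  exact: (pres_cat (pres_refl R [:: c]) (IH1 0 _ _ _ e1)).
- move=> [d [u [v [w [dn [e1 /fact_inj[-> -> -> ->]]]]]]].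
  have [c <-] := letter_digit_surj dn; rewrite !theta_cons.
  by rewrite (IH1 1 _ _ _ e1).
- move=> [r [v [w [Wr [e1 /fact_inj[-> -> -> _]]]]]].
  rewrite (IH1 1 _ _ _ e1); apply: (@pres_cat _ _ _ [::]); last exact: pres_refl.
  by apply: pres_rel; exists r.
Qed.

(** The tail [w] lets the induction pass through concatenation: [u] is replaced in front of
    [v ++ z], then [v] is replaced behind the prefix [u'] by [Dcat]. *)
Lemma word_derivable_complete (u v : word n) : 0 < n -> pres_eq R u v ->
  forall w, D (fact 0 (theta_inv (u ++ w)) (theta_inv (v ++ w)) 0).
Proof.
move=> n0.
have dl (a : letter n) : letter_digit a < 2 * n.
  by case: a => i e; rewrite /letter_digit; have := ltn_ord i; case: e => /=; lia.
have Dcat (p q r : word n) : D (fact 0 (theta_inv q) (theta_inv r) 0) ->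
    D (fact 0 (theta_inv (p ++ q)) (theta_inv (p ++ r)) 0).
  move=> Dqr; elim: p => [|a p IHp] //=.
  apply: (derivable_rule IHp IHp); do 2 right; left.
  by exists (letter_digit a), (theta_inv (p ++ q)), (theta_inv (p ++ r)).
elim=> {u v} [u|u v _ IHu|u v w _ IHu _ IHv|u u' v v' _ IHu _ IHv|[i e]|r [k Wk kr]] z.
- by apply: derivable_axiom; left; exists (theta_inv (u ++ z)).
- apply: (derivable_rule (IHu z) (IHu z)); right; left.
  by exists (theta_inv (u ++ z)), (theta_inv (v ++ z)).
- apply: derivable_rule (IHu z) (IHv z) _; left.
  by exists (theta_inv (u ++ z)), (theta_inv (v ++ z)), (theta_inv (w ++ z)).
- rewrite -!catA; apply: derivable_rule (IHu (v ++ z)) (Dcat u' _ _ (IHv z)) _; left.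
  by exists (theta_inv (u ++ v ++ z)), (theta_inv (u' ++ v ++ z)),
    (theta_inv (u' ++ v' ++ z)).
- apply: derivable_axiom; right; case: e; [right; left|left];
    exists (theta_inv z), (i : nat); rewrite muln2; split=> //=; exact: ltn_ord.
- have Dr (p : word n) : D (fact 1 (theta_inv p) (theta_inv z) (theta_inv (p ++ z))).
    elim: p => [|a p IHp].
      by apply: derivable_axiom; do 3 right; exists (theta_inv z).
    apply: (derivable_rule IHp IHp); do 3 right; left.
    by exists (letter_digit a), (theta_inv p), (theta_inv z), (theta_inv (p ++ z)).
  apply: (derivable_rule (Dr r) (Dr r)); do 4 right.
  exists k, (theta_inv z), (theta_inv (r ++ z)).
  by rewrite -kr thetaK.
Qed.

Lemma word_derivableP (k : nat) :
  0 < n -> word_derivable n j k <-> pres_eq R (theta n k) [::].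
Proof.
move=> n0; split=> [kD|/word_derivable_complete].
  exact: (word_derivable_sound kD (t := 0) erefl).
by move=> /(_ n0 [::]); rewrite cats0 thetaK.
Qed.
End WordProblem.

(** * Marked quotients *)

Section WordValue.
Variables (n : nat) (G : groupType) (s : 'I_n -> G).
Local Open Scope group_scope.

Lemma word_val_nil : word_val s [::] = 1.
Proof. by rewrite /word_val big_nil. Qed.

Lemma word_val_cons (a : letter n) (w : word n) :
  word_val s (a :: w) = (if a.2 then (s a.1)^-1 else s a.1) * word_val s w.
Proof. by rewrite /word_val big_cons. Qed.

Lemma word_val_cat (u v : word n) :
  word_val s (u ++ v) = word_val s u * word_val s v.
Proof. by rewrite /word_val big_cat. Qed.

Lemma word_val_cancel (a : letter n) : word_val s [:: a; flip a] = 1.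
Proof.
rewrite !word_val_cons word_val_nil mulg1; case: a => i [] /=.
  exact: mulVg.
exact: mulgV.
Qed.

(** Having the same value is a congruence that contains the cancellations and the relators, while
    [pres_eq] is the least one. *)
Lemma word_val_pres_eq (R : set (word n)) (u v : word n) :
  (forall r, R r -> word_val s r = 1) -> pres_eq R u v ->
  word_val s u = word_val s v.
Proof.
move=> sR; elim=> {u v} //.
- by move=> u v w _ -> _.
- by move=> u u' v v' _ eu _ ev; rewrite !word_val_cat eu ev.
- by move=> a; rewrite word_val_cancel word_val_nil.
- by move=> r /sR ->; rewrite word_val_nil.
Qed.

(** The cancellation of [inv_word w] against [w] holds in the presentation without relators, and
    transfers to any group. *)
Lemma word_val_inv (w : word n) : word_val s (inv_word w) = (word_val s w)^-1.
Proof.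
have /(word_val_pres_eq (R := set0)) := pres_eq_mulVw set0 w.
rewrite word_val_cat word_val_nil => /(_ (fun r => False_ind _)) e.
by apply: (mulIg (word_val s w)); rewrite e mulVg.
Qed.

End WordValue.

Lemma word_val_hom (n : nat) (G H : kmarked n) (f : G -> H) (w : word n) :
  marked_hom f -> f (word_val (mgen G) w) = word_val (mgen H) w.
Proof.
move=> [fM fg].
have f1 : f 1%g = 1%g by apply: (mulgI (f 1%g)); rewrite -fM !mulg1.
have fV x : f x^-1%g = ((f x)^-1)%g.
  by apply: (mulgI (f x)); rewrite -fM !mulgV.
elim: w => [|[i e] w IHw]; first by rewrite !word_val_nil.
by rewrite !word_val_cons fM IHw /=; case: e; rewrite ?fV fg.
Qed.

(** The generators force the value of a morphism on every word. Choosing a word for each element of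
    [G] defines the map, and inclusion of relations makes it independent of the choice. *)
Lemma marked_quotientP (n : nat) (G H : kmarked n) :
  marked_quotient G H <->
  forall w, word_val (mgen G) w = 1%g -> word_val (mgen H) w = 1%g.
Proof.
split=> [[f fh] w w1|GH].
  have [fM _] := fh; rewrite -(word_val_hom _ fh) w1.
  by apply: (mulgI (f 1%g)); rewrite -fM !mulg1.
have {}GH u v : word_val (mgen G) u = word_val (mgen G) v ->
    word_val (mgen H) u = word_val (mgen H) v.
  move=> uv; apply: (mulIg (word_val (mgen H) v)^-1%g).
  rewrite mulgV -word_val_inv -word_val_cat; apply: GH.
  by rewrite word_val_cat word_val_inv uv mulgV.
pose f (g : G) := word_val (mgen H) (projT1 (cid (mgenP g))).
have fE w : f (word_val (mgen G) w) = word_val (mgen H) w.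
  by apply: GH; case: cid.
exists f; split=> [x y|i].
  have [u <-] := mgenP x; have [v <-] := mgenP y.
  by rewrite -word_val_cat !fE word_val_cat.
have gE (K : kmarked n) : mgen K i = word_val (mgen K) [:: (i, false)].
  by rewrite word_val_cons word_val_nil mulg1.
by rewrite gE fE -gE.
Qed.

Lemma marked_quotient_refl (n : nat) (G : kmarked n) : marked_quotient G G.
Proof. by apply/marked_quotientP. Qed.

Lemma marked_quotient_trans (n : nat) (G H K : kmarked n) :
  marked_quotient G H -> marked_quotient H K -> marked_quotient G K.
Proof.
move=> /marked_quotientP GH /marked_quotientP HK.
by apply/marked_quotientP => w /GH/HK.
Qed.

(** Morphisms in the two directions are mutually inverse, since both composites fix the value of
    each word. *)
Lemma marked_isoP (n : nat) (G H : kmarked n) :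
  marked_iso G H <-> marked_quotient G H /\ marked_quotient H G.
Proof.
split=> [[f fh [g fK gK]]|[[f fh] [g gh]]].
  split; first by exists f.
  exists g; split=> [x y|i]; last by rewrite -(proj2 fh) fK.
  by rewrite -{1}[x]gK -{1}[y]gK -(proj1 fh) fK.
exists f => //; exists g => x.
  by have [w <-] := mgenP x; rewrite (word_val_hom _ fh) (word_val_hom _ gh).
by have [w <-] := mgenP x; rewrite (word_val_hom _ gh) (word_val_hom _ fh).
Qed.

Lemma mk_eqP (n : nat) (G H : kmarked n) : mk G = mk H <-> marked_iso G H.
Proof.
split=> [e|GH].
  (* Decidable equality on [nat] gives equality of the second components of the dependent pairs. *)
  have {}e := Eqdep_dec.inj_pair2_eq_dec _ PeanoNat.Nat.eq_dec _ _ _ _ e.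
  have /= -> := congr1 sval e.
  by apply/marked_isoP; split; apply: marked_quotient_refl.
congr existT; apply: eq_exist; rewrite predeqE => K.
move: GH => /marked_isoP[GH HG].
by split=> /marked_isoP[] ? ?; apply/marked_isoP; split;
  apply: marked_quotient_trans; eassumption.
Qed.

Lemma pres_word_val1 (n : nat) (R : set (word n)) (w : word n) :
  word_val (mgen (pres R)) w = 1%g <-> pres_eq R w [::].
Proof. by rewrite /= pres_word_val; apply: pres_piP. Qed.

(** Von Dyck's theorem. *)
Lemma pres_quotientP (n : nat) (R : set (word n)) (H : kmarked n) :
  marked_quotient (pres R) H <-> forall r, R r -> word_val (mgen H) r = 1%g.
Proof.
rewrite marked_quotientP; split=> [RH r Rr|RH w /pres_word_val1 w1].
  by apply/RH/pres_word_val1/pres_rel.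
by rewrite (word_val_pres_eq RH w1) word_val_nil.
Qed.

(** * Finite presentations and marked quotient algorithms *)

Lemma nuRP_pair (n i : nat) :
  0 < n -> nuRP (pair_code n i) = Some (mk (rp_group n i)).
Proof. by rewrite /nuRP pair_codeK => ->. Qed.

Lemma recursively_presentedP (n : nat) (G : kmarked n) :
  recursively_presented G <-> 0 < n /\ exists i, mk G = mk (rp_group n i).
Proof.
split=> [[p]|[n0 [i e]]]; last first.
  by exists (pair_code n i); rewrite e; apply: nuRP_pair.
rewrite /nuRP; case: (unpair p) => m i; case: ifP => // m0 /(congr1 (odflt (mk G)))/= e.
have em : m = n := congr1 (@projT1 _ _) e.
by case: n / em G e => G e; split=> //; exists i.
Qed.

(** A name of [H] lies in [W i] because [H] is a quotient of itself, hence [H] is a quotient of [G];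
    the situation is symmetric. *)
Lemma mqa_spec_unique (n i : nat) (x y : marked_group) :
  mqa_spec n i x -> mqa_spec n i y -> x = y.
Proof.
have le (G H : kmarked n) : recursively_presented H ->
    (forall j, marked_quotient G (rp_group n j) <-> W i j) ->
    (forall j, marked_quotient H (rp_group n j) <-> W i j) -> marked_quotient G H.
  move=> /recursively_presentedP[_ [j /mk_eqP/marked_isoP[Hj jH]]] GW HW.
  by apply: marked_quotient_trans jH; apply/GW/HW.
move=> [G [-> Grp GW]] [H [-> Hrp HW]].
by apply/mk_eqP/marked_isoP; split; apply: le.
Qed.

Lemma nuMQA_pair (n i : nat) (x : marked_group) :
  nuMQA (pair_code n i) = Some x <-> mqa_spec n i x.
Proof.
rewrite /nuMQA pair_codeK; case: pselect => [ex|nex]; last first.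
  by split=> // xP; case: nex; exists x.
case: cid => y /= yP; split=> [[<-] //|xP].
by rewrite (mqa_spec_unique yP xP).
Qed.

Lemma sub_conj_pair (X : Type) (nu mu : subnumbering X) (p q : nat) (x : X) :
  sub_conj nu mu (pair_code p q) = Some x <-> nu p = Some x /\ mu q = Some x.
Proof.
rewrite /sub_conj pair_codeK; case: (nu p) (mu q) => [y|] [z|]; try by split=> -[].
case: asboolP => [->|yz]; first by split=> [[->]|[]].
by split=> // -[[yx] [zx]]; case: yz; rewrite yx.
Qed.

Lemma finite_index : exists2 s, computable s &
  forall m, W (s m) = [set k | k \in Delta m].
Proof.
have [|s sc sP] := smn (P := fun m k => bit m k = true).
  by apply: semidec_bit; computability.
by exists s => // m; rewrite sP predeqE => k /=; rewrite mem_Delta.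
Qed.

Lemma word_derivable_val (n j k : nat) : 0 < n ->
  word_derivable n j k <-> word_val (mgen (rp_group n j)) (theta n k) = 1%g.
Proof. by move=> n0; rewrite word_derivableP // -pres_word_val1. Qed.

Lemma fp_quotientP (n m : nat) (H : kmarked n) :
  marked_quotient (fp_group n m) H <->
  forall k, k \in Delta m -> word_val (mgen H) (theta n k) = 1%g.
Proof.
rewrite pres_quotientP; split=> [mH k km|mH r [k km <-]]; last exact: mH.
by apply: mH; exists k.
Qed.

(** By von Dyck's theorem only finitely many relators have to be tested. Their names are below [m],
    so a bounded quantifier suffices. *)
Lemma fp_quotient_index : exists2 s, computable s & forall n m, 0 < n ->
  W (s (pair_code n m)) = [set j | marked_quotient (fp_group n m) (rp_group n j)].
Proof.
have [|s sc sP] := smn (P := fun p j => forall k, k < (unpair p).2 ->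
    bit (unpair p).2 k = false \/ word_derivable (unpair p).1 j k).
  apply: semidec_ball; last by computability.
  apply: semidec_or; first by apply: semidec_bit; computability.
  by apply: semidec_word_derivable; computability.
exists s => // n m n0; rewrite sP predeqE pair_codeK => j /=; rewrite fp_quotientP.
split=> mj k km.
  apply/word_derivable_val => //.
  by move: km; rewrite mem_Delta => km; case: (mj k (bit_ltn km)); rewrite ?km.
case: (boolP (bit m k)) => mk; [right|by left].
by apply/word_derivable_val/mj; rewrite ?mem_Delta.
Qed.

(* A case of the Rice-Shapiro theorem; [P e] below is W i, enumerated until e
   halts on e. *)
Lemma finite_subset_index (i q : nat) (Q : set nat -> Prop) :
  (forall j, W q j <-> Q (W j)) -> Q (W i) ->
  exists m, [set k | k \in Delta m] `<=` W i /\ Q [set k | k \in Delta m].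
Proof.
move=> QW QWi.
have [f fc fP] := semidec_W (computable_fst computable_id)
  (computable_snd computable_id).
have {}fP e x : W e x <-> exists t, f (pair_code (pair_code e x) t) = 0.
  by rewrite -fP pair_codeK.
(* An element [x] found in [W i] with witness [t] is kept only if no stage up to [pair_code x t]
   shows that [e] halts on [e]. *)
pose P e x := exists t, f (pair_code (pair_code i x) t) = 0 /\
  forall u, u < (pair_code x t).+1 -> 1 <= f (pair_code (pair_code e e) u).
have [|g gc gP] := smn (P := P); first by rewrite /P; semidecidability.
have [|h hc hP] := smn (P := fun _ e => W q (g e)).
  by apply: semidec_W; computability.
(* Diagonalization: [e] is an index of the set of those programs [e'] for which [Q (P e')] holds. *)
pose e := h 0; have eP : W e e <-> Q (P e) by rewrite /e hP QW gP.
have Psub : P e `<=` W i by move=> x [t [ft _]]; apply/fP; exists t.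
have [We|nWe] := pselect (W e e); last first.
  (* If [e] did not halt on [e], the enumeration would never be cut off, and [Q (W i)] would make
     [e] halt. *)
  case: (nWe); apply/eP; suff -> : P e = W i by [].
  apply/seteqP; split=> // x /fP[t ft]; exists t; split=> // u _.
  by rewrite lt0n; apply/eqP => fu; apply: nWe; apply/fP; exists u.
have /fP[u fu] := We.
(* At stage [u] the halting of [e] is visible, so a kept [x] satisfies [pair_code x t < u], hence
   [x < u], and [P e] is finite. *)
have [m mP] := finite_Delta (fun x => `[< P e x >]) u.
have mE : [set k | k \in Delta m] = P e.
  rewrite predeqE => x /=; rewrite mem_Delta mP; split=> [/andP[_ /asboolP]|Px] //.
  apply/andP; split; last exact/asboolP.
  case: Px => t [_ /(_ u)] Pu; rewrite ltnNge; apply/negP => ux.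
  have := Pu _; rewrite fu ltnS => /(_ _)/negP; case=> //.
  exact: leq_trans ux (leq_pair_codel _ _).
by exists m; rewrite mE; split=> //; apply/eP.
Qed.

Lemma finite_subpresentation (n i q : nat) :
  (forall j, W q j <-> marked_quotient (rp_group n i) (rp_group n j)) ->
  exists m, [set k | k \in Delta m] `<=` W i /\
    marked_quotient (rp_group n i) (fp_group n m).
Proof.
move=> qP; apply: (@finite_subset_index i q
  (fun S => marked_quotient (rp_group n i) (pres (theta n @` S)))) => //.
exact: marked_quotient_refl.
Qed.

(** The inclusion of relators provides the quotient map in the other direction. *)
Lemma fp_rp_iso (n m i : nat) :
  [set k | k \in Delta m] `<=` W i ->
  marked_quotient (rp_group n i) (fp_group n m) ->
  marked_iso (rp_group n i) (fp_group n m).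
Proof.
move=> mi im; apply/marked_isoP; split=> //.
apply/fp_quotientP => k /mi Wk; apply/pres_word_val1/pres_rel; by exists k.
Qed.

(** * The equivalence for a single marked group *)

Lemma finitely_presentedP (n : nat) (G : kmarked n) :
  finitely_presented G <-> exists m, marked_iso G (fp_group n m).
Proof.
split=> [[R GR]|[m Gm]].
  have [m mP] := finite_seq_Delta (map (@theta_inv n) R).
  exists m; suff -> : fp_group n m = pres [set r | r \in R] by [].
  congr pres; rewrite predeqE => r; split=> [[k /=]|/= rR].
    by rewrite mem_Delta mP => /mapP[w wR -> <-]; rewrite theta_invK.
  exists (theta_inv r); last exact: theta_invK.
  by rewrite /= mem_Delta mP map_f.
exists (map (theta n) (Delta m)).
suff <- : fp_group n m = pres [set r | r \in map (theta n) (Delta m)] by [].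
congr pres; rewrite predeqE => r; split=> [[k /= km <-]|/= /mapP[k km ->]].
  exact: map_f.
by exists k.
Qed.

Lemma semidec_ce (P : nat -> Prop) : semidec P -> ce P.
Proof.
move=> Pc; have [|s _ sP] := smn (P := fun _ => P); last by exists (s 0).
by apply: (semidec_comp Pc); computability.
Qed.

Lemma marked_iso_word (n : nat) (G H : kmarked n) (w : word n) :
  marked_iso G H -> word_val (mgen G) w = 1%g <-> word_val (mgen H) w = 1%g.
Proof.
by move=> /marked_isoP[/marked_quotientP GH /marked_quotientP HG]; split;
  [apply: GH|apply: HG].
Qed.

Lemma finitely_presented_semidec (k : nat) (G : kmarked k) : 0 < k ->
  finitely_presented G <-> semidecidable_WP G /\ semidecidable_MQ G.
Proof.
move=> k0; rewrite finitely_presentedP; split=> [[m Gm]|[[i iP] [q qP]]].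
  have [s _ sP] := finite_index; have [t _ tP] := fp_quotient_index.
  split.
    apply: semidec_ce.
    have := semidec_word_derivable (computable_const k) (computable_const (s m))
      computable_id.
    apply: semidec_ext => w /=.
    rewrite word_derivable_val // /rp_group sP; apply: iff_sym.
    exact: marked_iso_word.
  exists (t (pair_code k m)); rewrite tP // predeqE => j /=.
  move: Gm => /marked_isoP[Gm mG].
  by split; apply: marked_quotient_trans.
(* Here [W i] names all the words trivial in [G], so it gives a recursive presentation of [G]. *)
have Gi : marked_iso (rp_group k i) G.
  apply/marked_isoP; split.
    by apply/pres_quotientP => r [w]; rewrite iP /= => w1 <-.
  apply/marked_quotientP => w w1; apply/pres_word_val1/pres_rel.
  by exists (theta_inv w); rewrite ?iP /= theta_invK.
have [iG Gi'] := (marked_isoP _ _).1 Gi.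
have [j|m [mi im]] := finite_subpresentation (n := k) (i := i) (q := q).
  by rewrite qP /=; split; apply: marked_quotient_trans.
exists m; apply/marked_isoP.
have /marked_isoP[_ mi'] := fp_rp_iso mi im.
by split; apply: marked_quotient_trans; eassumption.
Qed.

(** * The equivalence of subnumberings *)

Lemma computable_sub_le (X : Type) (nu mu : subnumbering X) (f : nat -> nat) :
  computable f -> (forall p x, nu p = Some x -> mu (f p) = Some x) -> sub_le nu mu.
Proof.
move=> [c cP] fP; exists (fun p => Some (f p)).
  by exists c => x y; split=> [[<-] //|/(eval_functional (cP x))->].
by move=> p x /fP mux; exists (f p).
Qed.

Lemma nuFP_le : sub_le nuFP (sub_conj nuRP nuMQA).
Proof.
have [s sc sP] := finite_index; have [t tc tP] := fp_quotient_index.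
apply: (computable_sub_le (f := fun p => pair_code
  (pair_code (unpair p).1 (s (unpair p).2))
  (pair_code (unpair p).1 (t (pair_code (unpair p).1 (unpair p).2))))).
  by computability.
move=> p x; rewrite /nuFP; case: (unpair p) => n m /=.
case: ifP => // n0 [<-].
have e : rp_group n (s m) = fp_group n m by rewrite /rp_group sP.
apply/sub_conj_pair; split; first by rewrite nuRP_pair // e.
apply/nuMQA_pair; exists (fp_group n m); split=> //.
  by apply/recursively_presentedP; split=> //; exists (s m); rewrite e.
by move=> j; rewrite tP.
Qed.

Lemma le_nuFP : sub_le (sub_conj nuRP nuMQA) nuFP.
Proof.
have [s sc sP] := finite_index.
(* For [r] coding the names [<n, i>] and [<n', q>], this says that [Delta m] is part of [W i] and
   that the index [s m] of the resulting finite presentation lies in [W q]. *)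
pose P r m := (forall k, k < m ->
    bit m k = false \/ W (unpair (unpair r).1).2 k) /\
  W (unpair (unpair r).2).2 (s m).
have [|c [cP cT]] := search_semidec (P := P).
  apply: semidec_and; last by apply: semidec_W; computability.
  apply: semidec_ball; last by computability.
  apply: semidec_or; first by apply: semidec_bit; computability.
  by apply: semidec_W; computability.
have [F [d dF] FP] := partial_computable_code
  (* [Comp Fst Fst] reads the number of generators off the first name, and [c] finds the finite set
     of relators. *)
  (Pair (Comp Fst Fst) c).
exists F; first by exists d.
move=> r x; rewrite -(unpairK r); move: (unpair r).1 (unpair r).2 => {r} p q.
rewrite sub_conj_pair -(unpairK p) -(unpairK q).
move: (unpair p).1 (unpair p).2 (unpair q).1 (unpair q).2 => {p q} n i n' q.
set r := pair_code (pair_code _ _) _.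
rewrite nuMQA_pair /nuRP pair_codeK; case: ifP => [n0|_ []//] [[<-]].
move=> [G [e _ qP]].
(* Both names denote the same marked group, so their numbers of generators agree. *)
have en : n = n' := congr1 (@projT1 _ _) e.
case: n' / en G e qP @r => G /mk_eqP/marked_isoP[iG Gi] qP r.
have {}qP j : W q j <-> marked_quotient (rp_group n i) (rp_group n j).
  by rewrite -qP; split; apply: marked_quotient_trans.
have PE m : P r m <-> [set k | k \in Delta m] `<=` W i /\
    marked_quotient (rp_group n i) (fp_group n m).
  rewrite /P /r !pair_codeK /= qP /rp_group sP -/(rp_group n i) -/(fp_group n m).
  split=> -[mi im]; split=> // k km.
    by move: km => /=; rewrite mem_Delta => km; case: (mi k (bit_ltn km)); rewrite ?km.
  case: (boolP (bit m k)) => mk; [right|by left].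
  by apply: mi; rewrite /= mem_Delta.
have [m cm] : exists m, eval c r m.
  by apply: cT; have [m mP] := finite_subpresentation qP; exists m; apply/PE.
have /cP/PE[mi im] := cm.
exists (pair_code n m).
  apply/FP; exists n, m; split=> //; exists (unpair r).1 => //.
  by rewrite /r pair_codeK /= pair_codeK.
rewrite /nuFP pair_codeK n0; congr Some.
apply: esym; apply/mk_eqP; exact: fp_rp_iso.
Qed.

Theorem theorem7 :
  (forall (k : nat) (G : kmarked k), 0 < k ->
     (finitely_presented G <-> semidecidable_WP G /\ semidecidable_MQ G)) /\
  sub_equiv nuFP (sub_conj nuRP nuMQA).
Proof.
split; first exact: finitely_presented_semidec.
by split; [apply: nuFP_le|apply: le_nuFP].
Qed.
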